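(* Let $A$ be a Banach algebra with a right identity, and let $d$ be a linear map on $A$. If $d$ is a Jordan triple right derivation, then $d$ is a Jordan right derivation.
   Context: Banach algebras are over $\mathbb{C}$ and associative, and are not assumed to be commutative or unital. A right identity of $A$ is an element $e \in A$ with $ae = a$ for all $a \in A$. A linear map $d: A \to A$ (not assumed continuous) is a Jordan right derivation if $d(a^2) = 2d(a)a$ for all $a \in A$, and a Jordan triple right derivation if $d(a^3) = 3d(a)a^2$ for all $a \in A$. *)

(* Defs.v *)
From HB Require Import structures.
From mathcomp Require Import all_boot all_order all_algebra.
From mathcomp Require Import complex.
From mathcomp Require Import all_classical all_reals all_analysis.

Set Implicit Arguments.
Unset Strict Implicit.
Unset Printing Implicit Defensive.

Import GRing.Theory numFieldNormedType.Exports.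
Local Open Scope ring_scope.

(* The ring structures of ssralg carry a unit, so the product of a possibly
   non-unital Banach algebra is added directly on top of a Banach space. *)
HB.mixin Record CompleteNormedModule_isBanachAlgebra (K : numFieldType) A
    of CompleteNormedModule K A := {
  bmul : A -> A -> A;
  bmulA : associative bmul;
  bmulDl : left_distributive bmul +%R;
  bmulDr : right_distributive bmul +%R;
  bscalerAl : forall (k : K) (x y : A), k *: bmul x y = bmul (k *: x) y;
  bscalerAr : forall (k : K) (x y : A), k *: bmul x y = bmul x (k *: y);
  ler_bnormM : forall x y : A, `|bmul x y| <= `|x| * `|y|
}.

#[short(type="banachAlgType")]
HB.structure Definition BanachAlgebra (K : numFieldType) :=
  {A of CompleteNormedModule K A & CompleteNormedModule_isBanachAlgebra K A}.

Declare Scope balg_scope.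
Delimit Scope balg_scope with B.
Notation "x ** y" := (bmul x y) (at level 40, left associativity) : balg_scope.
Local Open Scope balg_scope.

Section JordanRightDerivations.
Context {K : numFieldType} {A : banachAlgType K}.

Definition jordan_right_derivation (d : {linear A -> A}) : Prop :=
  forall a : A, d (a ** a) = 2%:R *: (d a ** a).

Definition jordan_triple_right_derivation (d : {linear A -> A}) : Prop :=
  forall a : A, d (a ** a ** a) = 3%:R *: (d a ** (a ** a)).

End JordanRightDerivations.

(* Main.v *)
(* Polarizing d(a^3) = 3 d(a) a^2 gives
     d(a^2 b + a b a + b a^2) = 3 d(b) a^2 + 3 d(a) (a b + b a).
   Let e be a right identity. Then d(e) = d(e^3) = 3 d(e), so d(e) = 0. The pair
   (e, b) now gives 2 d(e b) + d(b) = 3 d(b), so d(e b) = d(b), and the pair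
   (a, e) gives 2 d(a^2) + d(e a^2) = 6 d(a) a, that is, 3 d(a^2) = 6 d(a) a. *)

Require Import Defs.
From mathcomp Require Import all_boot all_order all_algebra.
From mathcomp Require Import complex.
From mathcomp Require Import all_classical all_reals all_analysis.

Local Open Scope ring_scope.

Import GRing.Theory Num.Theory.
Local Open Scope balg_scope.

(** Expanding [F] on the diagonal at [u + v] only shows that the part quadratic in [u] and the part
    quadratic in [v] cancel; comparing the cases [u = x] and [u = x + x] separates them, at the cost
    of one division by 2. *)
Lemma triadditive_polarization (U V : zmodType) (F : U -> U -> U -> V) :
    (forall y z, {morph (fun x => F x y z) : u v / u + v}) ->
    (forall x z, {morph (fun y => F x y z) : u v / u + v}) ->
    (forall x y, {morph (fun z => F x y z) : u v / u + v}) ->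
    (forall v : V, v *+ 2 = 0 -> v = 0) ->
    (forall x, F x x x = 0) ->
  forall x y, F x x y + F x y x + F y x x = 0.
Proof.
move=> F1 F2 F3 V2 F0 x y.
have mixed u v : (F u u v + F u v u + F v u u)
    + (F v v u + F v u v + F u v v) = 0.
  have := F0 (u + v); rewrite F1 !F2 !F3 !F0 add0r addr0 => <-.
  by rewrite [LHS](AC (3*3) (((1*2)*6)*((3*5)*4))) /= -!addrA;
     congr (_ + (_ + _)); rewrite !addrA.
(* The two mixed terms scale as 4 and 2 when [x] is doubled. *)
have := mixed (x + x) y; rewrite !(F1, F2, F3) -!mulr2n -!mulrnDl => /V2.
by rewrite mulr2n -addrA mixed addr0.
Qed.

Lemma mulrSn_inj (K : numFieldType) (V : lmodType K) (n : nat) :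
  injective (fun v : V => v *+ n.+1).
Proof.
move=> u v /=; rewrite -!(@scaler_nat K).
by apply: scalerI; rewrite pnatr_eq0.
Qed.

Lemma bmul0r (K : numFieldType) (A : banachAlgType K) :
  left_zero 0 (@bmul K A).
Proof. by move=> x; rewrite -(scale0r 0) -bscalerAl !scale0r. Qed.

Section JordanTriple.
Context {K : numFieldType} {A : banachAlgType K} (d : {linear A -> A}).
Hypothesis dJ : jordan_triple_right_derivation d.
Implicit Types a b e : A.

(** The defect [F] below is additive in each argument, and [dJ] says exactly that it vanishes on the
    diagonal. *)
Lemma jordan_triple_polarized a b :
  d (a ** a ** b + a ** b ** a + b ** a ** a)
  = (d a ** (a ** b) + d a ** (b ** a) + d b ** (a ** a)) *+ 3.
Proof.
pose F x y z : A := d (x ** y ** z) - (d x ** (y ** z)) *+ 3.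
have F0 : F a a b + F a b a + F b a a = 0.
  apply: triadditive_polarization => [y z u v|x z u v|x y u v|v v0|x].
  - by rewrite /F !(bmulDl, linearD d) mulrnDl opprD addrACA.
  - by rewrite /F !(bmulDl, bmulDr, linearD d) mulrnDl opprD addrACA.
  - by rewrite /F !(bmulDr, linearD d) mulrnDl opprD addrACA.
  - by apply: (@mulrSn_inj K A 1); rewrite v0 mul0rn.
  - by rewrite /F dJ scaler_nat subrr.
apply/eqP; rewrite -subr_eq0 -[X in _ == X]F0 /F !(linearD d) !mulrnDl !opprD.
by rewrite [X in _ == X](AC ((2*2)*2) ((1*3*5)*(2*4*6))) /= !addrA.
Qed.

Section RightIdentity.
Variable e : A.
Hypothesis eR : right_id e (@bmul K A).

Lemma jordan_triple_right_id0 : d e = 0.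
Proof.
apply: (@mulrSn_inj K A 1); rewrite mul0rn; apply: (addrI (d e)).
(* On the right, [e] is written as the cube [e ** e ** e] so that [dJ] applies. *)
by rewrite -mulrS -scaler_nat addr0 -[in RHS](eR e) -[in RHS](eR (e ** e)) dJ !eR.
Qed.

(** A factor [e] on the left need not cancel in [A], but it does under [d]; this handles the term
    [e ** a ** a] below. *)
Lemma jordan_triple_mul_right_id b : d (e ** b) = d b.
Proof.
have := jordan_triple_polarized e b.
rewrite !eR jordan_triple_right_id0 !bmul0r !add0r !linearD /= mulrSr => /addIr.
by rewrite -mulr2n => /(@mulrSn_inj K A 1).
Qed.

Lemma jordan_triple_right_derivation_jordan : jordan_right_derivation d.
Proof.
move=> a; have := jordan_triple_polarized a e.
rewrite !eR jordan_triple_right_id0 bmul0r addr0 !linearD /= -bmulA jordan_triple_mul_right_id.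
(* Reassociating [d a ** (e ** a)] puts [e] to the right of [d a], where it is absorbed; then 3 is
   cancelled. *)
rewrite bmulA eR -mulr2n -mulrSr => /(@mulrSn_inj K A 2) ->.
by rewrite scaler_nat.
Qed.

End RightIdentity.
End JordanTriple.

Theorem theorem3p4 (R : realType) (A : banachAlgType R[i])
    (hA : exists e : A, right_id e (@bmul R[i] A)) (d : {linear A -> A}) :
  jordan_triple_right_derivation d -> jordan_right_derivation d.
Proof.
by case: hA => e eR dJ; apply: jordan_triple_right_derivation_jordan eR.
Qed.
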